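(* For every $P\in\mathbb P$ the following are equivalent: (1) $P$ is an extreme point of the convex set $E(P)=\{R\in\mathbb P: R(F)=P(F)\ \text{for all } F\in\mathcal F\}$; (2) $P$ satisfies the Blackwell–Dubins property; (3) for all $Q,R\in\mathbb P$ and $\alpha\in(0,1)$, if $P=\alpha Q+(1-\alpha)R$ then $P$ merges with $Q$ and with $R$.
   Context: Let $\Omega=\{0,1\}^{\mathbb N}$; $\omega^t$ is the cylinder of paths agreeing with $\omega$ in the first $t$ coordinates. $\mathcal F$ is the algebra of all finite unions of cylinders. $\Sigma$ is a fixed $\sigma$-algebra containing all cylinders; $\mathbb P$ the set of finitely additive probabilities on $(\Omega,\Sigma)$. $R(E\mid\omega^t)=R(E\cap\omega^t)/R(\omega^t)$ when $R(\omega^t)>0$. $P$ merges with $Q$ if for every $\varepsilon>0$, $\lim_{t\to\infty}Q(\{\omega:\sup_{E\in\Sigma}|P(E\mid\omega^t)-Q(E\mid\omega^t)|>\varepsilon\})=0$ (cylinders with $Q(\omega^t)>0=P(\omega^t)$ counted in the set). $Q\ll P$ means: for every sequence $(E_n)$ in $\Sigma$, $P(E_n)\to0$ implies $Q(E_n)\to0$. $P$ has the Blackwell–Dubins property if $P$ merges with every $Q\in\mathbb P$ with $Q\ll P$. *)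

(* Defs.v *)
From Stdlib Require Import Reals List.
Open Scope R_scope.

Definition Omega := nat -> bool.
Definition set := Omega -> Prop.

Definition cyl (w : Omega) (t : nat) : set :=
  fun w' => forall i, (i < t)%nat -> w' i = w i.

Definition setI (A B : set) : set := fun x => A x /\ B x.
Definition setT : set := fun _ => True.

Definition in_algF (E : set) : Prop :=
  exists l : list (Omega * nat),
    forall x, E x <-> exists p, In p l /\ cyl (fst p) (snd p) x.

Definition is_sigma_algebra (Sig : set -> Prop) : Prop :=
  Sig setT /\
  (forall E, Sig E -> Sig (fun x => ~ E x)) /\
  (forall A : nat -> set, (forall n, Sig (A n)) -> Sig (fun x => exists n, A n x)).

Definition contains_cylinders (Sig : set -> Prop) : Prop :=
  forall w t, Sig (cyl w t).

Definition fa_prob (Sig : set -> Prop) (P : set -> R) : Prop :=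
  (forall E, Sig E -> 0 <= P E) /\
  P setT = 1 /\
  (forall A B, Sig A -> Sig B -> (forall x, A x -> B x -> False) ->
     P (fun x => A x \/ B x) = P A + P B).

Definition same_on (Sig : set -> Prop) (P Q : set -> R) : Prop :=
  forall E, Sig E -> P E = Q E.

Definition cond (P : set -> R) (E : set) (w : Omega) (t : nat) : R :=
  P (setI E (cyl w t)) / P (cyl w t).

Definition merges (Sig : set -> Prop) (P Q : set -> R) : Prop :=
  forall eps, eps > 0 ->
    Un_cv (fun t => Q (fun w =>
             Q (cyl w t) > 0 /\
             (P (cyl w t) = 0 \/
              exists E, Sig E /\ Rabs (cond P E w t - cond Q E w t) > eps))) 0.

Definition abs_cont (Sig : set -> Prop) (Q P : set -> R) : Prop :=
  forall E : nat -> set, (forall n, Sig (E n)) ->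
    Un_cv (fun n => P (E n)) 0 -> Un_cv (fun n => Q (E n)) 0.

Definition blackwell_dubins (Sig : set -> Prop) (P : set -> R) : Prop :=
  forall Q, fa_prob Sig Q -> abs_cont Sig Q P -> merges Sig P Q.

Definition in_EP (Sig : set -> Prop) (P R0 : set -> R) : Prop :=
  fa_prob Sig R0 /\ forall F, in_algF F -> R0 F = P F.

Definition extreme_EP (Sig : set -> Prop) (P : set -> R) : Prop :=
  in_EP Sig P P /\
  forall Q R0 (a : R), in_EP Sig P Q -> in_EP Sig P R0 -> 0 < a < 1 ->
    (forall E, Sig E -> P E = a * Q E + (1 - a) * R0 E) ->
    same_on Sig Q P /\ same_on Sig R0 P.

Definition mixture_merging (Sig : set -> Prop) (P : set -> R) : Prop :=
  forall Q R0 (a : R), fa_prob Sig Q -> fa_prob Sig R0 -> 0 < a < 1 ->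
    (forall E, Sig E -> P E = a * Q E + (1 - a) * R0 E) ->
    merges Sig P Q /\ merges Sig P R0.

(* Main.v *)
(** The hard implication is from extremality to merging.  Given [Q << P], the
    charge [nu = Q - (Q - kP)^+] satisfies [0 <= nu <= kP] and, for large [k],
    is close to [Q] in total variation.  Its projections
    [nu_t(E) = sum over cylinders C of length t of nu(C)/P(C) * P(E /\ C)]
    form an [L^2]-bounded martingale, hence converge uniformly in [E] to some
    [nu'] with [0 <= nu' <= kP], even without countable additivity.  As [nu'] and
    [nu] agree on cylinders, [P + (nu - nu')/k] and [P - (nu - nu')/k] lie in
    [E(P)], so extremality forces [nu = nu'].  Thus the projections of [Q] tend
    to [Q] in total variation.  On a cylinder [C] the projection of [Q] is a
    multiple of [P], so gluing one bad event per bad cylinder bounds the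
    [Q]-mass of the bad cylinders by that distance.  Conversely, if [Q] agrees
    with [P] on cylinders, merging makes them close on most cylinders, and
    summing over these gives [Q = P]. *)
From Stdlib Require Import Reals List Lra Lia Classical IndefiniteDescription
  FunctionalExtensionality PropExtensionality.
From Coquelicot Require Import Coquelicot.
Require Import Defs.

(** * Sigma-algebras and finitely additive charges *)

Lemma set_ext (A B : set) : (forall x, A x <-> B x) -> A = B.
Proof.
  intro H. apply functional_extensionality. intro x.
  apply propositional_extensionality, H.
Qed.

(** Sign and normalisation are left free, so that differences such as [Q - proj P Q t] qualify. *)
Definition charge (Sig : set -> Prop) (mu : set -> R) : Prop :=
  forall A B, Sig A -> Sig B -> (forall x, A x -> B x -> False) ->
    mu (fun x => A x \/ B x) = mu A + mu B.

Lemma sigma_empty Sig : is_sigma_algebra Sig -> Sig (fun _ => False).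
Proof.
  intros (hT & hC & _). 
  replace (fun _ : Omega => False) with (fun x => ~ setT x).
  - now apply hC.
  - apply set_ext. unfold setT. tauto.
Qed.

Lemma sigma_union Sig A B :
  is_sigma_algebra Sig -> Sig A -> Sig B -> Sig (fun x => A x \/ B x).
Proof.
  intros (_ & _ & hU) hA hB.
  replace (fun x => A x \/ B x)
    with (fun x => exists n, (match n with O => A | S _ => B end) x).
  - apply hU. now intros [|n].
  - apply set_ext. intro x. split.
    + intros [[|n] H]; tauto.
    + intros [H | H]; [now exists O | now exists 1%nat].
Qed.

Lemma sigma_inter Sig A B :
  is_sigma_algebra Sig -> Sig A -> Sig B -> Sig (setI A B).
Proof.
  intros hS hA hB.
  replace (setI A B) with (fun x => ~ (~ A x \/ ~ B x)).
  - apply hS, sigma_union; trivial; now apply hS.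
  - apply set_ext. intro x. unfold setI. tauto.
Qed.

Lemma fa_prob_charge Sig P : fa_prob Sig P -> charge Sig P.
Proof. intros (_ & _ & H). exact H. Qed.

Lemma charge_empty Sig mu :
  is_sigma_algebra Sig -> charge Sig mu -> mu (fun _ => False) = 0.
Proof.
  intros hS hmu. pose proof (sigma_empty _ hS) as h0.
  pose proof (hmu _ _ h0 h0 (fun _ h _ => h)) as H. cbv beta in H.
  replace (fun x : Omega => False \/ False) with (fun _ : Omega => False) in H
    by (apply set_ext; tauto).
  lra.
Qed.

Lemma charge_split Sig mu A B :
  is_sigma_algebra Sig -> charge Sig mu -> Sig A -> Sig B ->
  mu A = mu (setI A B) + mu (setI A (fun x => ~ B x)).
Proof.
  intros hS hmu hA hB. rewrite <- hmu.
  - f_equal. apply set_ext. intro x. unfold setI. tauto.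
  - now apply sigma_inter.
  - apply sigma_inter; trivial. now apply hS.
  - unfold setI. tauto.
Qed.

Lemma fa_prob_mono Sig P A B :
  is_sigma_algebra Sig -> fa_prob Sig P -> Sig A -> Sig B ->
  (forall x, A x -> B x) -> P A <= P B.
Proof.
  intros hS hP hA hB hAB.
  rewrite (charge_split Sig P B A hS (fa_prob_charge _ _ hP) hB hA).
  replace (setI B A) with A
    by (apply set_ext; intro x; unfold setI; specialize (hAB x); tauto).
  assert (0 <= P (setI B (fun x => ~ A x))); [|lra].
  apply hP, sigma_inter; trivial. now apply hS.
Qed.

Lemma fa_prob_le1 Sig P A :
  is_sigma_algebra Sig -> fa_prob Sig P -> Sig A -> P A <= 1.
Proof.
  intros hS hP hA. destruct (hP) as (_ & h1 & _). rewrite <- h1.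
  apply (fa_prob_mono Sig); trivial. apply hS. unfold setT. tauto.
Qed.

Lemma setTI A : setI setT A = A.
Proof. apply set_ext. unfold setI, setT. tauto. Qed.

Lemma setIT A : setI A setT = A.
Proof. apply set_ext. unfold setI, setT. tauto. Qed.

(** * Cylinders and sums over words of length [t] *)

(** Appends the bit [b] to the first [t] coordinates of [w]; what follows is invisible to cylinders
    of length [S t]. *)
Definition ext (w : Omega) (t : nat) (b : bool) : Omega :=
  fun i => if Nat.eqb i t then b else w i.

Lemma cyl_ext_le w t b s : (s <= t)%nat -> cyl (ext w t b) s = cyl w s.
Proof.
  intro hs. apply set_ext. intro x. unfold cyl, ext.
  split; intros H i hi; specialize (H i hi);
    destruct (Nat.eqb_spec i t); trivial; lia.
Qed.

Lemma cyl_ext_S w t b x : cyl (ext w t b) (S t) x <-> cyl w t x /\ x t = b.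
Proof.
  unfold cyl, ext. split.
  - intro H. split.
    + intros i hi. specialize (H i ltac:(lia)).
      destruct (Nat.eqb_spec i t); trivial; lia.
    + specialize (H t ltac:(lia)). now rewrite Nat.eqb_refl in H.
  - intros [H hb] i hi. destruct (Nat.eqb_spec i t).
    + now subst.
    + apply H. lia.
Qed.

Lemma cyl0 w : cyl w 0 = setT.
Proof.
  apply set_ext. intro x. unfold cyl, setT. split; trivial. intros _ i hi. lia.
Qed.

Lemma cyl_refl w t : cyl w t w.
Proof. now intros i _. Qed.

Lemma cyl_eq w t x : cyl w t x -> cyl x t = cyl w t.
Proof.
  intro H. apply set_ext. intro y. unfold cyl in *.
  split; intros K i hi; rewrite (K i hi); rewrite (H i hi); trivial.
Qed.

(* The words of length [t] are represented by the paths extending them by zeros. *)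
Fixpoint sumw (t : nat) (f : Omega -> R) : R :=
  match t with
  | O => f (fun _ => false)
  | S t' => sumw t' (fun w => f (ext w t' true) + f (ext w t' false))
  end.

Lemma sumw_le t : forall f g, (forall w, f w <= g w) -> sumw t f <= sumw t g.
Proof.
  induction t as [|t IH]; intros f g H; simpl; [apply H|].
  apply IH. intro w. apply Rplus_le_compat; apply H.
Qed.

Lemma sumw_ext t f g : (forall w, f w = g w) -> sumw t f = sumw t g.
Proof. intro H. f_equal. now apply functional_extensionality. Qed.

Lemma sumw_plus t : forall f g,
  sumw t (fun w => f w + g w) = sumw t f + sumw t g.
Proof.
  induction t as [|t IH]; intros f g; simpl; [trivial|].
  rewrite <- IH. apply sumw_ext. intro w. ring.
Qed.

Lemma sumw_scal t c : forall f, sumw t (fun w => c * f w) = c * sumw t f.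
Proof.
  induction t as [|t IH]; intros f; simpl; [trivial|].
  rewrite <- IH. apply sumw_ext. intro w. ring.
Qed.

Lemma sumw_minus t f g : sumw t (fun w => f w - g w) = sumw t f - sumw t g.
Proof.
  replace (sumw t f - sumw t g) with (sumw t f + -1 * sumw t g) by ring.
  rewrite <- sumw_scal, <- sumw_plus. apply sumw_ext. intro w. ring.
Qed.

Lemma sumw_abs t f : Rabs (sumw t f) <= sumw t (fun w => Rabs (f w)).
Proof.
  apply Rabs_le. split.
  - replace (- sumw t (fun w => Rabs (f w)))
      with (-1 * sumw t (fun w => Rabs (f w))) by ring.
    rewrite <- sumw_scal. apply sumw_le. intro w.
    pose proof (Rle_abs (- f w)). rewrite Rabs_Ropp in H. lra.
  - apply sumw_le. intro w. apply Rle_abs.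
Qed.

Lemma charge_cyl_split Sig mu E w t :
  is_sigma_algebra Sig -> contains_cylinders Sig -> charge Sig mu -> Sig E ->
  mu (setI E (cyl w t)) =
  mu (setI E (cyl (ext w t true) (S t))) + mu (setI E (cyl (ext w t false) (S t))).
Proof.
  intros hS hc hmu hE. rewrite <- hmu.
  - f_equal. apply set_ext. intro x. unfold setI.
    rewrite !cyl_ext_S. destruct (x t); intuition congruence.
  - now apply sigma_inter.
  - now apply sigma_inter.
  - unfold setI. intros x. rewrite !cyl_ext_S. intuition congruence.
Qed.

(** The tower property in finitary form: [g] sees only the first [s] coordinates, so additivity of
    [mu] merges sibling cylinders one bit at a time. *)
Lemma sumw_refine Sig mu E (g : set -> R) s t :
  is_sigma_algebra Sig -> contains_cylinders Sig -> charge Sig mu -> Sig E ->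
  (s <= t)%nat ->
  sumw t (fun w => g (cyl w s) * mu (setI E (cyl w t))) =
  sumw s (fun w => g (cyl w s) * mu (setI E (cyl w s))).
Proof.
  intros hS hc hmu hE hst. induction hst as [|t hst IH]; trivial.
  rewrite <- IH. simpl. apply sumw_ext. intro w.
  rewrite (cyl_ext_le w t true s), (cyl_ext_le w t false s) by trivial.
  rewrite (charge_cyl_split Sig mu E w t) by trivial. ring.
Qed.

Lemma sumw_charge Sig mu E t :
  is_sigma_algebra Sig -> contains_cylinders Sig -> charge Sig mu -> Sig E ->
  sumw t (fun w => mu (setI E (cyl w t))) = mu E.
Proof.
  intros hS hc hmu hE.
  pose proof (sumw_refine Sig mu E (fun _ => 1) 0 t hS hc hmu hE ltac:(lia)) as H.
  simpl in H. rewrite cyl0, setIT in H.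
  rewrite Rmult_1_l in H. rewrite <- H. apply sumw_ext. intro w. ring.
Qed.

Lemma sumw_charge_cyl Sig mu t :
  is_sigma_algebra Sig -> contains_cylinders Sig -> charge Sig mu ->
  sumw t (fun w => mu (cyl w t)) = mu setT.
Proof.
  intros hS hc hmu. rewrite <- (sumw_charge Sig mu setT t) by (trivial; apply hS).
  apply sumw_ext. intro w. now rewrite setTI.
Qed.

(** Witnesses chosen separately on the cylinders are cut down to them and united. The induction
    glues two sibling cylinders at a time, and [mu] may be signed. *)
Lemma sumw_glue Sig mu t :
  is_sigma_algebra Sig -> contains_cylinders Sig -> charge Sig mu ->
  forall f, (forall w, exists E, Sig E /\ f w <= mu (setI E (cyl w t))) ->
  exists E, Sig E /\ sumw t f <= mu E.
Proof.
  intros hS hc hmu. induction t as [|t IH]; intros f H; simpl.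
  - destruct (H (fun _ => false)) as (E & hE & h). exists E. split; trivial.
    now rewrite cyl0, setIT in h.
  - apply IH. intro w.
    destruct (H (ext w t true)) as (E1 & h1 & k1).
    destruct (H (ext w t false)) as (E2 & h2 & k2).
    set (C1 := cyl (ext w t true) (S t)) in *.
    set (C2 := cyl (ext w t false) (S t)) in *.
    assert (hE : Sig (fun x => setI E1 C1 x \/ setI E2 C2 x))
      by (apply sigma_union; trivial; apply sigma_inter; trivial; apply hc).
    exists (fun x => setI E1 C1 x \/ setI E2 C2 x). split; trivial.
    rewrite (charge_cyl_split Sig) by trivial. fold C1 C2.
    assert (hd : forall x, C1 x -> C2 x -> False)
      by (unfold C1, C2; intro x; rewrite !cyl_ext_S; intuition congruence).
    replace (setI (fun x => setI E1 C1 x \/ setI E2 C2 x) C1) with (setI E1 C1)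
      by (apply set_ext; intro x; unfold setI; specialize (hd x); tauto).
    replace (setI (fun x => setI E1 C1 x \/ setI E2 C2 x) C2) with (setI E2 C2)
      by (apply set_ext; intro x; unfold setI; specialize (hd x); tauto).
    lra.
Qed.

(** * Events that depend on finitely many coordinates *)

Definition determined (A : set) (t : nat) : Prop :=
  forall x y, cyl x t y -> A x -> A y.

Lemma determined_in A t w : determined A t -> A w -> setI A (cyl w t) = cyl w t.
Proof.
  intros hA hw. apply set_ext. intro x. unfold setI. split; [tauto|].
  intro h. split; trivial. now apply (hA w).
Qed.

Lemma determined_out A t w :
  determined A t -> ~ A w -> setI A (cyl w t) = (fun _ => False).
Proof.
  intros hA hw. apply set_ext. intro x. unfold setI. split; [|tauto].
  intros [h k]. apply hw, (hA x); trivial. rewrite (cyl_eq w t x k). apply cyl_refl.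
Qed.

Lemma determined_sig Sig A t :
  is_sigma_algebra Sig -> contains_cylinders Sig -> determined A t -> Sig A.
Proof.
  intros hS hc hA.
  (* Induction from depth [t] back to the root: [n] counts the bits still to be fixed. *)
  assert (H : forall n s w, (n + s = t)%nat -> Sig (setI A (cyl w s))).
  { induction n as [|n IH]; intros s w hs.
    - simpl in hs. subst s. destruct (classic (A w)) as [h | h].
      + rewrite determined_in by trivial. apply hc.
      + rewrite determined_out by trivial. now apply sigma_empty.
    - replace (setI A (cyl w s)) with (fun x =>
        setI A (cyl (ext w s true) (S s)) x \/ setI A (cyl (ext w s false) (S s)) x).
      + apply sigma_union; trivial; apply IH; lia.
      + apply set_ext. intro x. unfold setI. rewrite !cyl_ext_S.
        destruct (x s); intuition congruence. }
  specialize (H t O (fun _ => false) ltac:(lia)). now rewrite cyl0, setIT in H.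
Qed.

Lemma determined_mono A s t : (s <= t)%nat -> determined A s -> determined A t.
Proof. intros hst hA x y h. apply hA. intros i hi. apply h. lia. Qed.

Lemma algF_determined F : in_algF F -> exists t, determined F t.
Proof.
  intros [l hl].
  replace F with (fun x => exists p, In p l /\ cyl (fst p) (snd p) x)
    by (apply set_ext; intro x; now rewrite hl).
  clear F hl. induction l as [|q l [t IH]].
  - exists O. intros x y _ (p & [] & _).
  - exists (Nat.max t (snd q)). intros x y hxy (p & [hp | hp] & h).
    + subst q. exists p. split; [now left|]. intros i hi.
      rewrite hxy by lia. now apply h.
    + destruct (IH x y) as (p' & h1 & h2).
      * intros i hi. apply hxy. lia.
      * now exists p.
      * exists p'. split; trivial. now right.
Qed.

(** * Projections onto densities constant on cylinders *)

(** The charge whose density with respect to [P] is [mu(C)/P(C)] on each cylinder [C] of length [t]: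
    the analogue of conditioning a density on the first [t] coordinates. *)
Definition proj (P mu : set -> R) (t : nat) (E : set) : R :=
  sumw t (fun w => mu (cyl w t) / P (cyl w t) * P (setI E (cyl w t))).

Lemma proj_charge Sig P mu t :
  is_sigma_algebra Sig -> contains_cylinders Sig -> charge Sig P ->
  charge Sig (proj P mu t).
Proof.
  intros hS hc hP A B hA hB hAB. unfold proj. rewrite <- sumw_plus.
  apply sumw_ext. intro w. rewrite <- Rmult_plus_distr_l, <- hP.
  - do 2 f_equal. apply set_ext. intro x. unfold setI. tauto.
  - apply sigma_inter; trivial.
  - apply sigma_inter; trivial.
  - unfold setI. intros x [h _] [k _]. exact (hAB x h k).
Qed.

(** Cylinders of length [t] are equal or disjoint. Once the right side is also split over words, the
    identity holds term by term. *)
Lemma proj_cyl Sig P mu t E w :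
  is_sigma_algebra Sig -> contains_cylinders Sig -> charge Sig P -> Sig E ->
  proj P mu t (setI E (cyl w t)) =
  mu (cyl w t) / P (cyl w t) * P (setI E (cyl w t)).
Proof.
  intros hS hc hP hE.
  rewrite <- (sumw_charge Sig P (setI E (cyl w t)) t)
    by (trivial; now apply sigma_inter).
  rewrite <- sumw_scal. apply sumw_ext. intro v.
  destruct (classic (exists x, cyl w t x /\ cyl v t x)) as [(x & hw & hv) | h].
  - now rewrite <- (cyl_eq w t x hw), <- (cyl_eq v t x hv).
  - replace (setI (setI E (cyl w t)) (cyl v t)) with (fun _ : Omega => False).
    + rewrite (charge_empty Sig) by trivial. ring.
    + apply set_ext. intro x. unfold setI. split; [tauto|].
      intros [[_ h1] h2]. apply h. now exists x.
Qed.

(** If [p = 0], domination forces [n = 0], so the quotient still behaves as a density on [P]-null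
    cylinders. *)
Lemma div_mul_dominated n p k :
  0 <= n -> n <= k * p -> 0 <= p -> 0 <= k -> 0 <= n / p <= k /\ n / p * p = n.
Proof.
  intros hn hnk hp hk. destruct hp as [hp | <-].
  - assert (h : n / p * p = n) by (field; lra). split; trivial. split.
    + apply Rmult_le_reg_r with p; lra.
    + apply Rmult_le_reg_r with p; lra.
  - assert (n = 0) by lra. subst n. unfold Rdiv. rewrite Rmult_0_l. lra.
Qed.

Lemma proj_bounds Sig P nu k t E :
  is_sigma_algebra Sig -> contains_cylinders Sig -> fa_prob Sig P -> 0 <= k ->
  (forall E, Sig E -> 0 <= nu E <= k * P E) -> Sig E ->
  0 <= proj P nu t E <= k * P E.
Proof.
  intros hS hc hP hk hnu hE. pose proof (fa_prob_charge _ _ hP) as hPc.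
  assert (H : forall w, 0 <= nu (cyl w t) / P (cyl w t) * P (setI E (cyl w t))
                   <= k * P (setI E (cyl w t))).
  { intro w. destruct (hnu _ (hc w t)).
    destruct (div_mul_dominated (nu (cyl w t)) (P (cyl w t)) k) as [[h1 h2] _]; trivial.
    { apply hP, hc. }
    assert (0 <= P (setI E (cyl w t))) by (apply hP, sigma_inter; trivial).
    split; [now apply Rmult_le_pos | now apply Rmult_le_compat_r]. }
  rewrite <- (sumw_charge Sig P E t), <- sumw_scal by trivial.
  replace 0 with (0 * sumw t (fun _ => 0)) by ring. rewrite <- sumw_scal.
  unfold proj. split; apply sumw_le; intro w; specialize (H w); lra.
Qed.

(** A cylinder of length [t] lies inside [F] or misses it; in the first case the quotient cancels,
    in the second both sides vanish. *)
Lemma proj_determined Sig P nu k s t F :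
  is_sigma_algebra Sig -> contains_cylinders Sig -> fa_prob Sig P -> 0 <= k ->
  charge Sig nu -> (forall E, Sig E -> 0 <= nu E <= k * P E) ->
  determined F s -> (s <= t)%nat -> proj P nu t F = nu F.
Proof.
  intros hS hc hP hk hnuc hnu hF hst.
  pose proof (determined_mono _ _ _ hst hF) as hFt.
  rewrite <- (sumw_charge Sig nu F t) by (trivial; now apply determined_sig with t).
  apply sumw_ext. intro w. destruct (classic (F w)) as [h | h].
  - rewrite determined_in by trivial. destruct (hnu _ (hc w t)).
    apply div_mul_dominated with k; trivial. apply hP, hc.
  - rewrite determined_out by trivial.
    rewrite !(charge_empty Sig) by (trivial; now apply fa_prob_charge). ring.
Qed.

(** * Uniform convergence of the projections through second moments *)

(** The squared [L^2(P)] norm of the density of [proj P nu t]. *)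
Definition energy (P nu : set -> R) (t : nat) : R :=
  sumw t (fun w => (nu (cyl w t) / P (cyl w t)) ^ 2 * P (cyl w t)).

Lemma energy_bound Sig P nu k t :
  is_sigma_algebra Sig -> contains_cylinders Sig -> fa_prob Sig P -> 0 <= k ->
  (forall E, Sig E -> 0 <= nu E <= k * P E) -> energy P nu t <= k ^ 2.
Proof.
  intros hS hc hP hk hnu.
  replace (k ^ 2) with (k ^ 2 * P setT) by (destruct hP as (_ & -> & _); ring).
  rewrite <- (sumw_charge_cyl Sig P t), <- sumw_scal by (trivial; now apply fa_prob_charge).
  apply sumw_le. intro w. destruct (hnu _ (hc w t)).
  assert (hp : 0 <= P (cyl w t)) by apply hP, hc.
  destruct (div_mul_dominated (nu (cyl w t)) (P (cyl w t)) k) as [[h1 h2] _]; trivial.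
  apply Rmult_le_compat_r; trivial. now apply pow_incr.
Qed.

(* Orthogonality of martingale increments. *)
Lemma energy_increment Sig P nu k s t :
  is_sigma_algebra Sig -> contains_cylinders Sig -> fa_prob Sig P -> 0 <= k ->
  charge Sig nu -> (forall E, Sig E -> 0 <= nu E <= k * P E) -> (s <= t)%nat ->
  sumw t (fun w => (nu (cyl w t) / P (cyl w t) - nu (cyl w s) / P (cyl w s)) ^ 2
                   * P (cyl w t))
  = energy P nu t - energy P nu s.
Proof.
  intros hS hc hP hk hnuc hnu hst.
  pose proof (fa_prob_charge _ _ hP) as hPc.
  assert (hT : Sig setT) by apply hS.
  pose proof (sumw_refine Sig nu setT (fun C => nu C / P C) s t
                hS hc hnuc hT hst) as H1.
  pose proof (sumw_refine Sig P setT (fun C => (nu C / P C) ^ 2) s t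
                hS hc hPc hT hst) as H2.
  assert (hr : forall w t, nu (cyl w t) / P (cyl w t) * P (cyl w t) = nu (cyl w t)).
  { intros w u. destruct (hnu _ (hc w u)).
    apply div_mul_dominated with k; trivial. apply hP, hc. }
  cbv beta in H1, H2.
  (* The square is expanded, with one density times [P] in the cross term rewritten as [nu]. The
     cross sum then refines along [nu] and the last sum along [P]; both collapse to the energy at
     [s], with total coefficient [-2 + 1]. *)
  transitivity (energy P nu t
    - 2 * sumw t (fun w => nu (cyl w s) / P (cyl w s) * nu (setI setT (cyl w t)))
    + sumw t (fun w => (nu (cyl w s) / P (cyl w s)) ^ 2 * P (setI setT (cyl w t)))).
  - unfold energy. rewrite <- sumw_scal, <- sumw_minus, <- sumw_plus.
    apply sumw_ext. intro w. rewrite setTI.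
    rewrite <- (hr w t) at 3. ring.
  - rewrite H1, H2.
    replace (sumw s (fun w => nu (cyl w s) / P (cyl w s) * nu (setI setT (cyl w s))))
      with (energy P nu s).
    + replace (sumw s (fun w => (nu (cyl w s) / P (cyl w s)) ^ 2
                                 * P (setI setT (cyl w s))))
        with (energy P nu s); [ring|].
      apply sumw_ext. intro w. now rewrite setTI.
    + apply sumw_ext. intro w. rewrite setTI.
      rewrite <- (hr w s) at 3. ring.
Qed.

Lemma energy_mono Sig P nu k s t :
  is_sigma_algebra Sig -> contains_cylinders Sig -> fa_prob Sig P -> 0 <= k ->
  charge Sig nu -> (forall E, Sig E -> 0 <= nu E <= k * P E) -> (s <= t)%nat ->
  energy P nu s <= energy P nu t.
Proof.
  intros hS hc hP hk hnuc hnu hst.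
  assert (0 <= energy P nu t - energy P nu s); [|lra].
  rewrite <- (energy_increment Sig P nu k) by trivial.
  replace 0 with (0 * sumw t (fun _ => 0)) by ring. rewrite <- sumw_scal.
  apply sumw_le. intro w. rewrite Rmult_0_l.
  apply Rmult_le_pos; [apply pow2_ge_0 | apply hP, hc].
Qed.

(** An elementary substitute for Cauchy-Schwarz: the density increment [h] satisfies
    [|h| <= d + h^2/d], and this is summed against [P]. Uniformity in [E] comes from bounding the
    mass of [E] within a cylinder by that of the cylinder. *)
Lemma proj_increment Sig P nu k s t E d :
  is_sigma_algebra Sig -> contains_cylinders Sig -> fa_prob Sig P -> 0 <= k ->
  charge Sig nu -> (forall E, Sig E -> 0 <= nu E <= k * P E) -> (s <= t)%nat ->
  Sig E -> 0 < d ->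
  Rabs (proj P nu t E - proj P nu s E) <= d + (energy P nu t - energy P nu s) / d.
Proof.
  intros hS hc hP hk hnuc hnu hst hE hd.
  pose proof (fa_prob_charge _ _ hP) as hPc.
  unfold proj at 2.
  rewrite <- (sumw_refine Sig P E (fun C => nu C / P C) s t) by trivial.
  unfold proj. rewrite <- sumw_minus.
  eapply Rle_trans; [apply sumw_abs|].
  rewrite <- (energy_increment Sig P nu k s t) by trivial.
  replace d with (d * P setT) at 1 by (destruct hP as (_ & -> & _); ring).
  rewrite <- (sumw_charge_cyl Sig P t), <- sumw_scal by trivial.
  assert (hdiv : forall x, x / d = / d * x) by (intro; apply Rmult_comm).
  rewrite hdiv.
  rewrite <- sumw_scal, <- sumw_plus. apply sumw_le. intro w.
  rewrite <- Rmult_minus_distr_r, Rabs_mult.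
  set (h := nu (cyl w t) / P (cyl w t) - nu (cyl w s) / P (cyl w s)).
  assert (hEw : Sig (setI E (cyl w t))) by (apply sigma_inter; trivial).
  assert (h0 : 0 <= P (setI E (cyl w t))) by now apply hP.
  assert (h1 : P (setI E (cyl w t)) <= P (cyl w t))
    by (apply (fa_prob_mono Sig); trivial; unfold setI; tauto).
  rewrite (Rabs_right (P (setI _ _))) by lra.
  assert (h2 : Rabs h <= d + / d * h ^ 2).
  { rewrite <- (pow2_abs h). pose proof (Rabs_pos h) as ha.
    set (a := Rabs h) in *.
    assert (d + / d * a ^ 2 - a = / d * ((a - d) ^ 2 + a * d)) by (field; lra).
    assert (0 <= / d * ((a - d) ^ 2 + a * d)); [|lra].
    apply Rmult_le_pos; [left; now apply Rinv_0_lt_compat|].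
    pose proof (pow2_ge_0 (a - d)). nra. }
  pose proof (Rabs_pos h) as h3.
  apply Rle_trans with (Rabs h * P (cyl w t)).
  - now apply Rmult_le_compat_l.
  - apply Rle_trans with ((d + / d * h ^ 2) * P (cyl w t)).
    + apply Rmult_le_compat_r; trivial. lra.
    + lra.
Qed.

Lemma proj_cauchy Sig P nu k :
  is_sigma_algebra Sig -> contains_cylinders Sig -> fa_prob Sig P -> 0 <= k ->
  charge Sig nu -> (forall E, Sig E -> 0 <= nu E <= k * P E) ->
  forall eps, 0 < eps -> exists T, forall s t E, (T <= s)%nat -> (T <= t)%nat ->
    Sig E -> Rabs (proj P nu t E - proj P nu s E) <= eps.
Proof.
  intros hS hc hP hk hnuc hnu eps heps.
  assert (hcv : {l | Un_cv (energy P nu) l}).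
  { apply growing_cv.
    - intro n. apply (energy_mono Sig P nu k); trivial. lia.
    - exists (k ^ 2). intros x [n ->]. now apply (energy_bound Sig). }
  destruct hcv as [l hl].
  (* With [d = eps / 2], an energy gap below [d ^ 2] makes each of the two terms of the increment
     bound at most [eps / 2]. *)
  destruct (CV_Cauchy _ (exist _ l hl) ((eps / 2) ^ 2)) as [T hT].
  { apply pow_lt. lra. }
  exists T.
  assert (H : forall s t E, (T <= s)%nat -> (s <= t)%nat -> Sig E ->
            Rabs (proj P nu t E - proj P nu s E) <= eps).
  { intros s t E hs hst hE.
    eapply Rle_trans;
      [apply (proj_increment Sig P nu k s t E (eps / 2)); trivial; lra|].
    specialize (hT t s ltac:(lia) hs).
    unfold R_dist in hT. apply Rabs_def2 in hT.
    assert ((energy P nu t - energy P nu s) / (eps / 2) <= eps / 2); [|lra].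
    apply Rmult_le_reg_r with (eps / 2); [lra|].
    replace ((energy P nu t - energy P nu s) / (eps / 2) * (eps / 2))
      with (energy P nu t - energy P nu s) by (field; lra).
    simpl in hT. lra. }
  intros s t E hs ht hE. destruct (Nat.le_gt_cases s t).
  - now apply H.
  - rewrite Rabs_minus_sym. apply H; trivial. lia.
Qed.

(** * Extremality identifies the limit of the projections *)

Lemma extreme_proj_cvg Sig P nu k :
  is_sigma_algebra Sig -> contains_cylinders Sig -> fa_prob Sig P ->
  extreme_EP Sig P -> 0 < k ->
  charge Sig nu -> (forall E, Sig E -> 0 <= nu E <= k * P E) ->
  forall eps, 0 < eps -> exists T, forall t E, (T <= t)%nat -> Sig E ->
    Rabs (nu E - proj P nu t E) <= eps.
Proof.
  intros hS hc hP [_ hext] hk hnuc hnu.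
  assert (hk' : 0 <= k) by lra.
  pose proof (fa_prob_charge _ _ hP) as hPc.
  pose proof (proj_cauchy Sig P nu k hS hc hP hk' hnuc hnu) as hC.
  set (lim := fun E => real (Lim_seq (fun t => proj P nu t E))).
  assert (hlim : forall E, Sig E -> is_lim_seq (fun t => proj P nu t E) (lim E)).
  { intros E hE. apply Lim_seq_correct', ex_lim_seq_cauchy_corr. intros e.
    destruct (hC (e / 2)) as [T hT]; [destruct e; simpl; lra|].
    exists T. intros n m hn hm. specialize (hT m n E hm hn hE).
    destruct e; simpl in *; lra. }
  assert (hlc : charge Sig lim).
  { intros A B hA hB hAB.
    assert (hAB' : Sig (fun x => A x \/ B x)) by now apply sigma_union.
    pose proof (is_lim_seq_plus' _ _ _ _ (hlim A hA) (hlim B hB)) as H.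
    pose proof (hlim _ hAB') as H'.
    apply (is_lim_seq_ext _ (fun t => proj P nu t A + proj P nu t B)) in H'.
    - apply is_lim_seq_unique in H. apply is_lim_seq_unique in H'.
      rewrite H in H'. now injection H'.
    - intro t. now apply (proj_charge Sig). }
  assert (hlb : forall E, Sig E -> 0 <= lim E <= k * P E).
  { intros E hE.
    assert (hb := fun t => proj_bounds Sig P nu k t E hS hc hP hk' hnu hE).
    split.
    - refine (is_lim_seq_le (fun _ => 0) _ 0 (lim E) _ (is_lim_seq_const 0) (hlim E hE)).
      intro t. apply hb.
    - refine (is_lim_seq_le _ (fun _ => k * P E) (lim E) (k * P E) _ (hlim E hE)
                (is_lim_seq_const _)).
      intro t. apply hb. }
  (* The projections are constant in [t] on [F] once [t] reaches a length that determines [F]. *)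
  assert (hld : forall F, in_algF F -> lim F = nu F).
  { intros F hF. destruct (algF_determined F hF) as [s hs].
    assert (hF' : Sig F) by now apply determined_sig with s.
    pose proof (hlim F hF') as H.
    apply (is_lim_seq_ext_loc _ (fun _ => nu F)) in H.
    - apply is_lim_seq_unique in H. rewrite Lim_seq_const in H. now injection H.
    - exists s. intros t ht. now apply (proj_determined Sig P nu k s). }
  assert (halgT : in_algF setT).
  { exists ((fun _ => false, O) :: nil). intro x. split; [|now unfold setT].
    intros _. exists (fun _ => false, O). split; [now left|].
    intros i hi. simpl in hi. lia. }
  (* Both [nu] and [lim] lie between [0] and [k * P], so their difference over [k] lies between [-P]
     and [P], which keeps the perturbation nonnegative. It vanishes on the algebra by [hld]. *)
  assert (hQ : forall c, -1 <= c <= 1 ->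
             in_EP Sig P (fun E => P E + c * ((nu E - lim E) / k))).
  { intros c hcc. split; [split; [|split]|].
    - intros E hE. specialize (hnu E hE). specialize (hlb E hE).
      assert (-P E <= (nu E - lim E) / k <= P E).
      { split; apply Rmult_le_reg_r with k; trivial;
          unfold Rdiv; rewrite Rmult_assoc, Rinv_l by lra; lra. }
      nra.
    - rewrite (hld setT halgT). destruct hP as (_ & -> & _).
      unfold Rdiv. ring.
    - intros A B hA hB hAB. rewrite hPc, hnuc, hlc by trivial. unfold Rdiv. ring.
    - intros F hF. rewrite (hld F hF). unfold Rdiv. ring. }
  assert (heq : forall E, Sig E -> lim E = nu E).
  { intros E hE.
    (* [P] is the midpoint of the perturbations with [c = 1] and [c = -1]. *)
    destruct (hext _ _ (1 / 2) (hQ 1 ltac:(lra)) (hQ (-1) ltac:(lra))) as [H _].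
    - lra.
    - intros F hF. cbv beta. lra.
    - specialize (H E hE). cbv beta in H.
      assert (h : (nu E - lim E) / k * k = 0) by nra.
      unfold Rdiv in h. rewrite Rmult_assoc, Rinv_l in h; lra. }
  intros eps heps. destruct (hC eps heps) as [T hT]. exists T.
  intros t E ht hE. rewrite <- heq by trivial.
  (* Let [s] tend to infinity in the Cauchy bound, whose [T] is the same for all events. *)
  refine (is_lim_seq_le_loc (fun s => Rabs (proj P nu s E - proj P nu t E))
            (fun _ => eps) (Rabs (lim E - proj P nu t E)) eps _ _ (is_lim_seq_const eps)).
  - exists T. intros s hs. now apply hT.
  - apply (is_lim_seq_abs _ (lim E - proj P nu t E)).
    apply is_lim_seq_minus'; [now apply hlim | apply is_lim_seq_const].
Qed.

(** * Truncating [Q] at a multiple of [P] *)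

(** [D] is the Jordan positive part of [Q - k * P]: its value at [E] is the supremum of that charge
    over events inside [E]. Then [Q - D] is nonnegative and dominated by [k * P], and the last
    clause controls the mass removed. *)
Lemma positive_part Sig P Q k :
  is_sigma_algebra Sig -> fa_prob Sig P -> fa_prob Sig Q -> 0 <= k ->
  exists D, charge Sig D /\
    (forall E, Sig E -> 0 <= D E <= Q E /\ Q E - k * P E <= D E) /\
    (forall c, (forall A, Sig A -> Q A - k * P A <= c) -> D setT <= c).
Proof.
  intros hS hP hQ hk.
  pose proof (fa_prob_charge _ _ hP) as hPc.
  pose proof (fa_prob_charge _ _ hQ) as hQc.
  set (vals := fun (E : set) (r : R) => exists A : set,
         Sig A /\ (forall x, A x -> E x) /\ r = Q A - k * P A).
  assert (hQP : forall A, Sig A -> Q A - k * P A <= Q A).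
  { intros A hA. assert (0 <= k * P A); [|lra].
    apply Rmult_le_pos; trivial. now apply hP. }
  pose proof (sigma_empty _ hS) as h0.
  assert (hv0 : forall E, vals E 0).
  { intro E. exists (fun _ => False). split; [trivial|]. split; [tauto|].
    rewrite !(charge_empty Sig) by trivial. ring. }
  assert (hb : forall E, bound (vals E)).
  { intro E. exists 1. intros r (A & hA & _ & ->).
    pose proof (fa_prob_le1 Sig Q A hS hQ hA). specialize (hQP A hA). lra. }
  set (D := fun E => proj1_sig (completeness (vals E) (hb E) (ex_intro _ 0 (hv0 E)))).
  assert (hD : forall E, is_lub (vals E) (D E))
    by (intro E; unfold D; apply proj2_sig).
  exists D. split; [|split].
  - intros A B hA hB hAB. apply Rle_antisym.
    + apply hD. intros r (X & hX & hXAB & ->).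
      assert (hXA : Sig (setI X A)) by now apply sigma_inter.
      assert (hXB : Sig (setI X (fun x => ~ A x)))
        by (apply sigma_inter; trivial; now apply hS).
      rewrite (charge_split Sig Q X A), (charge_split Sig P X A) by trivial.
      assert (h1 : Q (setI X A) - k * P (setI X A) <= D A).
      { apply hD. exists (setI X A). split; trivial. split; trivial. now intros x []. }
      assert (h2 : Q (setI X (fun x => ~ A x)) - k * P (setI X (fun x => ~ A x)) <= D B).
      { apply hD. exists (setI X (fun x => ~ A x)). split; trivial. split; trivial.
        intros x [h1' h2']. destruct (hXAB x h1'); tauto. }
      lra.
    (* The suprema for [A] and [B] are bounded in turn, leaving [X] inside [A] and [Y] inside [B],
       whose union competes in the supremum for the union. *)
    + assert (H : D A <= D (fun x => A x \/ B x) - D B); [|lra].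
      apply hD. intros r (X & hX & hXA & ->).
      assert (H : D B <= D (fun x => A x \/ B x) - (Q X - k * P X)); [|lra].
      apply hD. intros r (Y & hY & hYB & ->).
      assert (H : Q X - k * P X + (Q Y - k * P Y) <= D (fun x => A x \/ B x)); [|lra].
      apply hD. exists (fun x => X x \/ Y x).
      split; [now apply sigma_union|]. split.
      * intros x [h|h]; auto.
      * assert (hXY : forall x, X x -> Y x -> False)
          by (intros x h h'; exact (hAB x (hXA x h) (hYB x h'))).
        rewrite hPc, hQc by trivial. ring.
  - intros E hE. split; [split|].
    + apply hD, hv0.
    + apply hD. intros r (A & hA & hAE & ->).
      pose proof (fa_prob_mono Sig Q A E hS hQ hA hE hAE). specialize (hQP A hA). lra.
    + apply hD. now exists E.
  - intros c h. apply hD. intros r (A & hA & _ & ->). now apply h.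
Qed.

(** If every [k] failed, the multipliers [INR (S n)] would yield events with [P]-mass below
    [1/(n+1)] but [Q]-mass above [eps]. *)
Lemma abs_cont_uniform Sig P Q :
  is_sigma_algebra Sig -> fa_prob Sig P -> fa_prob Sig Q -> abs_cont Sig Q P ->
  forall eps, 0 < eps ->
  exists k, 0 < k /\ forall A, Sig A -> Q A - k * P A <= eps.
Proof.
  intros hS hP hQ hac eps heps. apply NNPP. intro hn.
  assert (H : forall n : nat, exists A, Sig A /\ eps < Q A - INR (S n) * P A).
  { intro n. apply NNPP. intro h. apply hn. exists (INR (S n)).
    split; [apply lt_0_INR; lia|]. intros A hA. apply Rnot_lt_le. intro h'.
    apply h. now exists A. }
  apply functional_choice in H. destruct H as [A hA].
  assert (hcv : Un_cv (fun n => P (A n)) 0).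
  { intros e he. destruct (archimed_cor1 e he) as (N & hN & hN0).
    exists N. intros n hn'. destruct (hA n) as [h1 h2].
    pose proof (proj1 hP _ h1). pose proof (fa_prob_le1 Sig Q _ hS hQ h1).
    unfold R_dist. rewrite Rminus_0_r, Rabs_right by lra.
    apply Rle_lt_trans with (/ INR N); trivial.
    assert (hNp : 0 < INR N) by now apply lt_0_INR.
    apply Rmult_le_reg_l with (INR N); trivial. rewrite Rinv_r by lra.
    assert (INR N <= INR (S n)) by (apply le_INR; lia). nra. }
  destruct (hac A (fun n => proj1 (hA n)) hcv eps heps) as [N hN].
  specialize (hN N ltac:(lia)). destruct (hA N) as [h1 h2].
  pose proof (proj1 hP _ h1). pose proof (pos_INR (S N)).
  unfold R_dist in hN. rewrite Rminus_0_r in hN. apply Rabs_def2 in hN.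
  assert (0 <= INR (S N) * P (A N)) by now apply Rmult_le_pos. lra.
Qed.

(** Truncating [Q] to [nu] costs at most [D setT <= eps / 2], and [proj P nu t] lies below
    [proj P Q t]. In this one-sided estimate the truncation error therefore enters only once. *)
Lemma extreme_abs_cont_proj_cvg Sig P Q :
  is_sigma_algebra Sig -> contains_cylinders Sig -> fa_prob Sig P ->
  extreme_EP Sig P -> fa_prob Sig Q -> abs_cont Sig Q P ->
  forall eps, 0 < eps -> exists T, forall t E, (T <= t)%nat -> Sig E ->
    Q E - proj P Q t E <= eps.
Proof.
  intros hS hc hP hext hQ hac eps heps.
  destruct (abs_cont_uniform Sig P Q hS hP hQ hac (eps / 2)) as (k & hk & hkQ); [lra|].
  destruct (positive_part Sig P Q k) as (D & hDc & hD & hDT); trivial; [lra|].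
  specialize (hDT _ hkQ).
  pose proof (fa_prob_charge _ _ hP) as hPc.
  pose proof (fa_prob_charge _ _ hQ) as hQc.
  set (nu := fun E => Q E - D E).
  destruct (extreme_proj_cvg Sig P nu k hS hc hP hext hk) with (eps := eps / 2)
    as [T hT].
  - intros A B hA hB hAB. unfold nu. rewrite hQc, hDc by trivial. ring.
  - intros E hE. unfold nu. specialize (hD E hE). lra.
  - lra.
  - exists T. intros t E ht hE. specialize (hT t E ht hE).
    assert (hle : proj P nu t E <= proj P Q t E).
    { apply sumw_le. intro w. unfold nu. destruct (hD _ (hc w t)) as [[h1 _] _].
      apply Rmult_le_compat_r; [apply hP, sigma_inter; trivial|].
      assert (hp : 0 <= P (cyl w t)) by apply hP, hc.
      destruct hp as [hp | hp].
      - apply Rmult_le_compat_r; [left; now apply Rinv_0_lt_compat | lra].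
      (* On a [P]-null cylinder both quotients are [0], since [/ 0 = 0]. *)
      - rewrite <- hp. unfold Rdiv. rewrite Rinv_0. lra. }
    assert (hDE : D E <= D setT).
    { rewrite (charge_split Sig D setT E), setTI by (trivial; apply hS).
      assert (hE' : Sig (setI setT (fun x => ~ E x)))
        by (rewrite setTI; now apply hS).
      destruct (hD _ hE') as [[h _] _]. lra. }
    apply Rabs_le_between in hT. unfold nu in hT. unfold nu in hle. lra.
Qed.

(** * Bad cylinders: from projections to merging *)

(** A verbatim copy of the exceptional set in [merges], so that [fold] recognises it there. *)
Definition bad (Sig : set -> Prop) (P Q : set -> R) (eps : R) (t : nat) : set :=
  fun w => Q (cyl w t) > 0 /\
    (P (cyl w t) = 0 \/
     exists E, Sig E /\ Rabs (cond P E w t - cond Q E w t) > eps).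

Lemma bad_determined Sig P Q eps t : determined (bad Sig P Q eps t) t.
Proof.
  intros x y hxy. unfold bad, cond. now rewrite (cyl_eq x t y hxy).
Qed.

Lemma cond_compl Sig P E w t :
  is_sigma_algebra Sig -> contains_cylinders Sig -> fa_prob Sig P -> Sig E ->
  0 < P (cyl w t) -> cond P (fun x => ~ E x) w t = 1 - cond P E w t.
Proof.
  intros hS hc hP hE hp. unfold cond.
  pose proof (charge_split Sig P (cyl w t) E hS (fa_prob_charge _ _ hP) (hc w t) hE) as H.
  replace (setI (cyl w t) E) with (setI E (cyl w t)) in H
    by (apply set_ext; unfold setI; tauto).
  replace (setI (cyl w t) (fun x => ~ E x)) with (setI (fun x => ~ E x) (cyl w t)) in H
    by (apply set_ext; unfold setI; tauto).
  field_simplify_eq; lra.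
Qed.

Lemma bad_witness Sig P Q eps t w :
  is_sigma_algebra Sig -> contains_cylinders Sig -> fa_prob Sig P -> fa_prob Sig Q ->
  bad Sig P Q eps t w -> P (cyl w t) <> 0 ->
  exists E, Sig E /\ cond Q E w t - cond P E w t > eps.
Proof.
  intros hS hc hP hQ [hq [hp0 | (E & hE & h)]] hp; [contradiction|].
  assert (0 < P (cyl w t)) by (pose proof (proj1 hP _ (hc w t)); lra).
  destruct (Rle_dec 0 (cond Q E w t - cond P E w t)) as [hs | hs].
  - exists E. split; trivial. rewrite Rabs_minus_sym, Rabs_right in h; lra.
  - exists (fun x => ~ E x). split; [now apply hS|].
    rewrite !(cond_compl Sig) by trivial. rewrite Rabs_right in h; lra.
Qed.

(** On a bad cylinder [C], the charge [Q - proj P Q t] gives some event a mass of at least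
    [eps * Q(C)], or gives [C] itself mass [Q(C)] if [P(C) = 0]; hence the minimum with [1]. Gluing
    these events yields one event to which [c] applies. *)
Lemma bad_bound Sig P Q eps t c :
  is_sigma_algebra Sig -> contains_cylinders Sig -> fa_prob Sig P -> fa_prob Sig Q ->
  0 < eps ->
  (forall E, Sig E -> Q E - proj P Q t E <= c) ->
  Rmin eps 1 * Q (bad Sig P Q eps t) <= c.
Proof.
  intros hS hc hP hQ heps hE.
  pose proof (fa_prob_charge _ _ hP) as hPc.
  pose proof (fa_prob_charge _ _ hQ) as hQc.
  set (B := bad Sig P Q eps t).
  pose proof (bad_determined Sig P Q eps t) as hdet. fold B in hdet.
  assert (hB : Sig B) by now apply determined_sig with t.
  set (mu := fun E => Q E - proj P Q t E).
  assert (hmu : charge Sig mu).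
  { intros X Y hX hY hXY. unfold mu. rewrite hQc by trivial.
    rewrite (proj_charge Sig P Q t hS hc hPc X Y) by trivial. ring. }
  destruct (sumw_glue Sig mu t hS hc hmu
              (fun w => Rmin eps 1 * Q (setI B (cyl w t)))) as (E & hE1 & hE2).
  2: { rewrite sumw_scal, (sumw_charge Sig) in hE2 by trivial.
       specialize (hE E hE1). unfold mu in hE2. lra. }
  intro w.
  destruct (classic (B w)) as [hw | hw].
  2: { exists (fun _ => False). split; [now apply sigma_empty|].
       rewrite (determined_out B t w hdet hw), (charge_empty Sig) by trivial.
       replace (setI (fun _ => False) (cyl w t)) with (fun _ : Omega => False)
         by (apply set_ext; unfold setI; tauto).
       rewrite (charge_empty Sig) by trivial. lra. }
  rewrite (determined_in B t w hdet hw).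
  pose proof (Rmin_l eps 1). pose proof (Rmin_r eps 1).
  assert (hq : Q (cyl w t) > 0) by apply hw.
  assert (hmuE : forall E, Sig E -> mu (setI E (cyl w t)) =
    Q (setI E (cyl w t)) - Q (cyl w t) / P (cyl w t) * P (setI E (cyl w t))).
  { intros E hE0. unfold mu. now rewrite (proj_cyl Sig). }
  destruct (Req_dec (P (cyl w t)) 0) as [hp | hp].
  - exists setT. split; [apply hS|]. rewrite hmuE by apply hS.
    rewrite setTI, hp, Rmult_0_r. nra.
  - destruct (bad_witness Sig P Q eps t w hS hc hP hQ hw hp) as (E & hE0 & h).
    exists E. split; trivial. rewrite hmuE by trivial. unfold cond in h.
    replace (Q (setI E (cyl w t)) - Q (cyl w t) / P (cyl w t) * P (setI E (cyl w t)))
      with (Q (cyl w t) * (Q (setI E (cyl w t)) / Q (cyl w t)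
              - P (setI E (cyl w t)) / P (cyl w t))) by (field; lra).
    rewrite Rmult_comm. apply Rmult_le_compat_l; lra.
Qed.

Lemma extreme_blackwell_dubins Sig P :
  is_sigma_algebra Sig -> contains_cylinders Sig -> fa_prob Sig P ->
  extreme_EP Sig P -> blackwell_dubins Sig P.
Proof.
  intros hS hc hP hext Q hQ hac eps heps d hd.
  assert (hm : 0 < Rmin eps 1) by (apply Rmin_pos; lra).
  (* Dividing by [Rmin eps 1] in [bad_bound] leaves [d / 2]. *)
  destruct (extreme_abs_cont_proj_cvg Sig P Q hS hc hP hext hQ hac
              (Rmin eps 1 * (d / 2))) as [T hT]; [nra|].
  exists T. intros t ht. fold (bad Sig P Q eps t).
  assert (hB : Sig (bad Sig P Q eps t))
    by (apply determined_sig with t; trivial; apply bad_determined).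
  pose proof (proj1 hQ _ hB) as h0.
  unfold R_dist. rewrite Rminus_0_r, Rabs_right by lra.
  apply Rle_lt_trans with (d / 2); [|lra].
  apply Rmult_le_reg_l with (Rmin eps 1); trivial.
  apply (bad_bound Sig); trivial. intros E hE. now apply hT.
Qed.

(** * Mixtures, and the way back to extremality *)

(** On events [a * Q <= P], so [P]-mass below [a * eps] gives [Q]-mass below [eps]. *)
Lemma mixture_abs_cont Sig P Q R0 a :
  fa_prob Sig Q -> fa_prob Sig R0 -> 0 < a < 1 ->
  (forall E, Sig E -> P E = a * Q E + (1 - a) * R0 E) -> abs_cont Sig Q P.
Proof.
  intros hQ hR ha hmix E hE hcv eps heps.
  destruct (hcv (a * eps)) as [N hN]; [nra|]. exists N. intros n hn.
  specialize (hN n hn). unfold R_dist in *. rewrite Rminus_0_r in *.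
  rewrite (hmix _ (hE n)) in hN.
  pose proof (proj1 hQ _ (hE n)). pose proof (proj1 hR _ (hE n)).
  rewrite Rabs_right by lra. apply Rabs_def2 in hN. nra.
Qed.

Lemma blackwell_dubins_mixture Sig P :
  blackwell_dubins Sig P -> mixture_merging Sig P.
Proof.
  intros hbd Q R0 a hQ hR ha hmix. split; apply hbd; trivial.
  - now apply (mixture_abs_cont Sig P Q R0 a).
  - apply (mixture_abs_cont Sig P R0 Q (1 - a)); trivial; [lra|].
    intros E hE. rewrite (hmix E hE). ring.
Qed.

Lemma merges_same Sig P Q :
  is_sigma_algebra Sig -> contains_cylinders Sig ->
  fa_prob Sig P -> in_EP Sig P Q -> merges Sig P Q -> same_on Sig Q P.
Proof.
  intros hS hc hP [hQ hQP] hm E hE.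
  pose proof (fa_prob_charge _ _ hP) as hPc.
  pose proof (fa_prob_charge _ _ hQ) as hQc.
  assert (hcyl : forall w t, Q (cyl w t) = P (cyl w t)).
  { intros w t. apply hQP. exists ((w, t) :: nil). intro x. split.
    - intro h. exists (w, t). split; [now left | trivial].
    - intros (p & [<- | []] & h). exact h. }
  assert (H : forall eps, 0 < eps -> Rabs (Q E - P E) <= eps).
  { intros eps heps. destruct (hm (eps / 2) ltac:(lra) (eps / 2)) as [T hT]; [lra|].
    specialize (hT T ltac:(lia)). fold (bad Sig P Q (eps / 2) T) in hT.
    set (B := bad Sig P Q (eps / 2) T) in *.
    pose proof (bad_determined Sig P Q (eps / 2) T) as hdet. fold B in hdet.
    assert (hB : Sig B) by now apply determined_sig with T.
    unfold R_dist in hT. rewrite Rminus_0_r in hT. apply Rabs_def2 in hT.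
    rewrite <- (sumw_charge Sig Q E T), <- (sumw_charge Sig P E T), <- sumw_minus
      by trivial.
    eapply Rle_trans; [apply sumw_abs|].
    (* A good cylinder contributes at most [eps / 2] times its mass. A bad one contributes at most
       its whole mass, since [P] and [Q] agree on cylinders, and the bad ones total less than
       [eps / 2]. *)
    apply Rle_trans with
      (sumw T (fun w => eps / 2 * Q (cyl w T) + Q (setI B (cyl w T)))).
    2: { rewrite sumw_plus, sumw_scal, (sumw_charge Sig), (sumw_charge_cyl Sig)
           by trivial.
         destruct hQ as (_ & -> & _). lra. }
    apply sumw_le. intro w.
    assert (hEw : Sig (setI E (cyl w T))) by (apply sigma_inter; trivial).
    pose proof (proj1 hQ _ hEw) as q0. pose proof (proj1 hP _ hEw) as p0.
    assert (q1 : Q (setI E (cyl w T)) <= Q (cyl w T))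
      by (apply (fa_prob_mono Sig); trivial; unfold setI; tauto).
    assert (p1 : P (setI E (cyl w T)) <= P (cyl w T))
      by (apply (fa_prob_mono Sig); trivial; unfold setI; tauto).
    rewrite <- hcyl in p1.
    destruct (classic (B w)) as [hw | hw].
    - rewrite (determined_in B T w hdet hw). apply Rabs_le. nra.
    - rewrite (determined_out B T w hdet hw), (charge_empty Sig) by trivial.
      (* A [Q]-null cylinder is never in [bad], so it is treated apart: [P] and [Q] both vanish
         inside it. *)
      destruct (Req_dec (Q (cyl w T)) 0) as [hz | hz].
      + apply Rabs_le. nra.
      + assert (hq : 0 < Q (cyl w T)) by lra.
        assert (h : Rabs (cond P E w T - cond Q E w T) <= eps / 2).
        { apply Rnot_lt_le. intro h. apply hw. split; trivial. right. now exists E. }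
        unfold cond in h. rewrite <- hcyl in h.
        replace (Q (setI E (cyl w T)) - P (setI E (cyl w T))) with
          (- (P (setI E (cyl w T)) / Q (cyl w T) - Q (setI E (cyl w T)) / Q (cyl w T))
           * Q (cyl w T)) by (field; lra).
        rewrite Rabs_mult, Rabs_Ropp, (Rabs_right (Q (cyl w T))) by lra.
        rewrite Rplus_0_r. apply Rmult_le_compat_r; lra. }
  assert (h0 : Rabs (Q E - P E) <= 0).
  { apply Rnot_lt_le. intro h. specialize (H (Rabs (Q E - P E) / 2)). lra. }
  apply Rabs_le_between in h0. lra.
Qed.

Lemma mixture_extreme Sig P :
  is_sigma_algebra Sig -> contains_cylinders Sig -> fa_prob Sig P ->
  mixture_merging Sig P -> extreme_EP Sig P.
Proof.
  intros hS hc hP hm. split; [now split|].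
  intros Q R0 a hQ hR ha hmix.
  destruct (hm Q R0 a (proj1 hQ) (proj1 hR) ha hmix).
  split; now apply merges_same.
Qed.

Theorem theorem8 (Sig : set -> Prop)
  (hSig : is_sigma_algebra Sig) (hcyl : contains_cylinders Sig)
  (P : set -> R) (hP : fa_prob Sig P) :
  (extreme_EP Sig P <-> blackwell_dubins Sig P) /\
  (blackwell_dubins Sig P <-> mixture_merging Sig P).
Proof.
  pose proof (extreme_blackwell_dubins Sig P hSig hcyl hP).
  pose proof (blackwell_dubins_mixture Sig P).
  pose proof (mixture_extreme Sig P hSig hcyl hP).
  tauto.
Qed.
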